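(* For any $\epsilon > 0$, every (possibly randomised) two-pass streaming algorithm for \textsf{Maximum Bipartite Matching} with approximation ratio $\frac{2}{3} + \epsilon$ that solely computes a \textsc{Greedy} matching in the first pass requires $n^{1+\Omega(\frac{1}{\log \log n})}$ space, where $n$ is the number of vertices in the input graph.
   Context: \textsf{Maximum Bipartite Matching} (\textsf{MBM}): given a bipartite graph $G=(A,B,E)$ on $n$ vertices, whose edges arrive one by one as a stream in arbitrary (adversarial) order, output a matching of $G$; a $\rho$-approximation outputs (with constant success probability) a matching of size at least $\rho\,\mu(G)$, where $\mu(G)$ is the maximum matching size. A two-pass streaming algorithm reads the edge stream twice, and its space is the maximum amount of memory it maintains. The \textsc{Greedy} matching algorithm processes the edges in stream order, starting from $M=\emptyset$, and adds the current edge $e$ to $M$ whenever $M\cup\{e\}$ is still a matching; it outputs a maximal matching. An algorithm ''solely computes a \textsc{Greedy} matching in the first pass'' if during the first pass it only runs \textsc{Greedy}, so that the only information carried into the second pass is the \textsc{Greedy} matching $M$; the second pass is arbitrary. *)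

(* Defs.v *)
From HB Require Import structures.
From mathcomp Require Import all_boot all_order all_algebra.

Set Implicit Arguments.
Unset Strict Implicit.
Unset Printing Implicit Defensive.

(* An edge of a bipartite graph on the vertex set 'I_n is an ordered pair whose
   first component lies in A and whose second component lies in B = ~: A. *)
Definition edge (n : nat) : finType := ('I_n * 'I_n)%type.

Record bigraph (n : nat) := BiGraph {
  side : {set 'I_n};
  edges : {set edge n};
  edges_bip : edges \subset setX side (~: side)
}.

(* A-endpoints and B-endpoints are different vertices, so two edges can only
   meet in equal first components or equal second components. *)
Definition matching (n : nat) (M : {set edge n}) : bool :=
  [forall e in M, forall f in M,
     (e != f) ==> ((e.1 != f.1) && (e.2 != f.2))].

Definition matching_of (n : nat) (G : bigraph n) (M : {set edge n}) : bool :=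
  (M \subset edges G) && matching M.

Definition mu (n : nat) (G : bigraph n) : nat :=
  \max_(M : {set edge n} | matching_of G M) #|M|.

Definition stream_of (n : nat) (G : bigraph n) (sigma : seq (edge n)) : bool :=
  perm_eq sigma (enum (edges G)).

Definition greedy (n : nat) (sigma : seq (edge n)) : {set edge n} :=
  foldl (fun M e => if matching (e |: M) then e |: M else M) set0 sigma.

(* A deterministic two-pass algorithm with s bits of memory for n-vertex
   graphs.  Only the space is bounded: the transitions are arbitrary functions
   and may depend on n and on the vertex class A (hence on B). *)
Record two_pass (n s : nat) := TwoPass {
  tp_init : {set 'I_n} -> s.-tuple bool;
  tp_step1 : {set 'I_n} -> s.-tuple bool -> edge n -> s.-tuple bool;
  tp_step2 : {set 'I_n} -> s.-tuple bool -> edge n -> s.-tuple bool;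
  tp_output : {set 'I_n} -> s.-tuple bool -> {set edge n}
}.

Definition first_pass (n s : nat) (a : two_pass n s) (A : {set 'I_n})
    (sigma : seq (edge n)) : s.-tuple bool :=
  foldl (tp_step1 a A) (tp_init a A) sigma.

Definition run (n s : nat) (a : two_pass n s) (A : {set 'I_n})
    (sigma : seq (edge n)) : {set edge n} :=
  tp_output a A (foldl (tp_step2 a A) (first_pass a A sigma) sigma).

(* After the first pass the memory holds an encoding of the Greedy matching and
   nothing else.  Prefixes of streams are streams of subgraphs, so this holds
   throughout the first pass. *)
Definition greedy_first_pass (n s : nat) (a : two_pass n s) : Prop :=
  forall A : {set 'I_n}, exists enc : {set edge n} -> s.-tuple bool,
    {in [pred M : {set edge n} | (M \subset setX A (~: A)) && matching M] &,
       injective enc} /\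
    forall (G : bigraph n) (sigma : seq (edge n)),
      side G = A -> stream_of G sigma -> first_pass a A sigma = enc (greedy sigma).

From mathcomp Require Import all_classical all_reals all_analysis.
Import Order.TTheory GRing.Theory Num.Theory.
Local Open Scope classical_set_scope.
Local Open Scope ring_scope.

(* A randomised algorithm is a random deterministic one; the random seed is not
   charged to the space.  As an edge occurs only once in each pass, fresh coins
   at every step are covered: the seed can hold separate coins for every edge
   and pass. *)
Record rand_two_pass (d : measure_display) (Omega : measurableType d)
    (n s : nat) := RandTwoPass {
  rtp_det :> Omega -> two_pass n s;
  rtp_meas : forall (A : {set 'I_n}) (sigma : seq (edge n)) (M : {set edge n}),
    measurable [set w | run (rtp_det w) A sigma = M]
}.

(* On every graph and every stream order, with probability at least p, the
   output is a matching of G with at least rho * mu G edges. *)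
Definition approximates (R : realType) (d : measure_display)
    (Omega : measurableType d) (P : probability Omega R) (n s : nat)
    (a : rand_two_pass Omega n s) (rho p : R) : Prop :=
  forall (G : bigraph n) (sigma : seq (edge n)), stream_of G sigma ->
    (p%:E <= P [set w | let M := run (a w) (side G) sigma in
                        matching_of G M /\ (rho * (mu G)%:R <= #|M|%:R)%R])%E.

(* Main.v *)
(* One-pass lower bound of Goel, Kapralov and Khanna, run in the second pass.
   Let [N = #|V|].  Take a Ruzsa-Szemeredi graph on two copies of [V] whose edges
   split into many induced matchings of size almost [N / 2].  Its vertices are
   the points of a cyclic grid, the [i]-th matching is a translation from the
   points with small coordinate sum along the [i]-th codeword to those with sum
   shifted by half the period, and the codewords come from a code with small
   pairwise agreement.
   The stream starts with the identity matching between the two copies, continues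
   with the induced matchings, from each of which a hidden random subset is
   removed, and ends with edges joining the vertices outside the [i]-th matching
   to new vertices.  The identity matching already blocks every later edge,
   so Greedy returns it on all instances and the first pass is worthless.  The
   maximum matching has size at least [3 N / 2], but without edges of the [i]-th
   induced matching only about [N] can be reached.  So the memory at the moment
   when [i] is revealed must determine a constant fraction of the [i]-th matching,
   which a Chernoff bound turns into space of order [N] times the number of
   matchings. *)
Require Import Defs.
From HB Require Import structures.
From mathcomp Require Import all_boot all_order all_algebra.
From mathcomp Require Import all_classical all_reals all_analysis.
From mathcomp Require Import zify ring lra.
From mathcomp Require Import measurable_realfun fintype finset.
Import Order.TTheory GRing.Theory Num.Theory.
Local Open Scope ring_scope.

Set Implicit Arguments.
Unset Strict Implicit.
Unset Printing Implicit Defensive.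

(** * Codes with small pairwise agreement *)

Definition agree (w b : nat) (f g : {ffun 'I_w -> 'I_b}) : nat :=
  #|[set j | f j == g j]|.

Lemma agreexx (w b : nat) (f : {ffun 'I_w -> 'I_b}) : agree f f = w.
Proof.
rewrite -[RHS](card_ord w) -cardsT.
by apply: eq_card => j; rewrite !inE eqxx.
Qed.

Lemma leq_card_bigcup (I T : finType) (Q : pred I) (F : I -> {set T}) :
  (#|\bigcup_(i | Q i) F i| <= \sum_(i | Q i) #|F i|)%N.
Proof.
elim/big_rec2: _ => [|i n A _ leAn]; first by rewrite cards0.
by rewrite (leq_trans (leq_card_setU _ _)) ?leq_add2l.
Qed.

(** Union bound over the sets [J] of at least [t] agreement positions: there are at most [2 ^ w] of
    them, and fixing [g] on [J] leaves at most [b ^ (w - t)] choices. *)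
Lemma card_agree_ge (w b t : nat) (f : {ffun 'I_w -> 'I_b}) : (0 < b)%N ->
  (#|[set g | t <= agree f g]| <= 2 ^ w * b ^ (w - t))%N.
Proof.
move=> b_gt0.
pose F (J : {set 'I_w}) :=
  [set g : {ffun 'I_w -> 'I_b} | [forall j in J, f j == g j]].
have cardF (J : {set 'I_w}) : (t <= #|J|)%N -> (#|F J| <= b ^ (w - t))%N.
  move=> leJ.
  have -> : #|F J| = #|family (fun j : 'I_w =>
                          if j \in J then pred1 (f j) else predT)|.
    apply: eq_card => g; rewrite inE; apply/forall_inP/familyP => [fg j|fg j Jj].
      by case: ifP => // Jj; rewrite inE eq_sym; apply: fg.
    by move: (fg j); rewrite Jj inE eq_sym.
  rewrite card_family foldrE big_map big_enum /=.
  rewrite (eq_bigr (fun j => if j \notin J then b else 1%N)) => [|j _]; last first.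
    by case: ifP => _ /=; [rewrite card1 | rewrite card_ord].
  rewrite -big_mkcond /= prod_nat_const leq_pexp2l //.
  have := cardC J; rewrite card_ord; move: leJ.
  rewrite (_ : #|[predC J]| = #|[pred j | j \notin J]|) //; lia.
have sub : [set g | (t <= agree f g)%N] \subset
    \bigcup_(J : {set 'I_w} | (t <= #|J|)%N) F J.
  apply/subsetP => g; rewrite inE => le_t; apply/bigcupP.
  exists [set j | f j == g j] => //.
  by rewrite inE; apply/forall_inP => j; rewrite inE.
apply: leq_trans (subset_leq_card sub) _; apply: leq_trans (leq_card_bigcup _ _) _.
apply: (@leq_trans (\sum_(J : {set 'I_w} | (t <= #|J|)%N) b ^ (w - t))%N).
  exact: leq_sum.
rewrite sum_nat_const leq_mul2r; apply/orP; right.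
rewrite -[X in (_ <= 2 ^ X)%N]card_ord -[in (2 ^ _)%N]cardsT -card_powerset powersetT cardsT.
exact: max_card.
Qed.

(* Gilbert-Varshamov: the balls around a maximal code cover the space. *)
Lemma code_exists (w b t : nat) : (0 < b)%N -> (t <= w)%N ->
  exists C : {set {ffun 'I_w -> 'I_b}},
    {in C &, forall f g, f != g -> (agree f g < t)%N} /\
    (b ^ t <= #|C| * 2 ^ w)%N.
Proof.
move=> b_gt0 le_tw.
pose isC (C : {set {ffun 'I_w -> 'I_b}}) :=
  [forall f in C, forall g in C, (f != g) ==> (agree f g < t)%N].
have isC0 : isC set0 by apply/forall_inP => f; rewrite inE.
have [C /maxsetP[CC maxC] _] := maxset_exists isC0.
have agreeC (f g : {ffun 'I_w -> 'I_b}) : agree f g = agree g f.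
  by apply: eq_card => j; rewrite !inE eq_sym.
exists C; split => [f g fC gC fg|].
  by move/forall_inP/(_ f fC)/forall_inP/(_ g gC)/implyP/(_ fg): CC.
have cover : setT \subset \bigcup_(f in C) [set g | (t <= agree f g)%N].
  apply/subsetP => g _; apply/bigcupP; apply/exists_inP.
  apply: contraT => /exists_inPn far.
  have gC : g \notin C.
    by apply/negP => gC; move: (far g gC); rewrite inE agreexx le_tw.
  have /maxC/(_ (subsetUr _ _)) eqC : isC (g |: C)%SET.
    apply/forall_inP => f fC; apply/forall_inP => h hC; apply/implyP => fh.
    move: fC hC; rewrite !in_setU1.
    case/predU1P => [fE|fC]; case/predU1P => [hE|hC].
    - by rewrite fE hE eqxx in fh.
    - by move: (far h hC); rewrite inE -ltnNge fE agreeC.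
    - by move: (far f fC); rewrite inE -ltnNge hE.
    - by move/forall_inP/(_ f fC)/forall_inP/(_ h hC)/implyP/(_ fh): CC.
  by rewrite -eqC setU11 in gC.
have := leq_trans (subset_leq_card cover) (leq_card_bigcup _ _).
rewrite cardsT card_ffun !card_ord => le1.
have: (b ^ w <= #|C| * (2 ^ w * b ^ (w - t)))%N.
  apply: leq_trans le1 _; rewrite -sum_nat_const.
  by apply: leq_sum => f _; apply: card_agree_ge.
rewrite -{1}(subnK le_tw) expnD mulnA [(b ^ _ * _)%N]mulnC leq_pmul2r //.
by rewrite expn_gt0 b_gt0.
Qed.

(** * The Ruzsa-Szemeredi graph on a cyclic grid *)

Lemma val_ZpD (q : nat) (a : 'Z_q) (n : nat) : (1 < q)%N ->
  nat_of_ord (a + n%:R) = ((a + n) %% q)%N.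
Proof. by move=> q_gt1; rewrite -{1}(natr_Zp a) -natrD val_Zp_nat. Qed.

(** Coordinates are indexed by pairs of a position and a letter, so a word selects one coordinate
    per position and is itself a 0/1 point of the grid. *)
Definition grid (q w b : nat) := {ffun 'I_w * 'I_b -> 'Z_q}.

Definition coord_sum (q w b : nat) (f : {ffun 'I_w -> 'I_b}) (x : grid q w b) :
  'Z_q := \sum_j x (j, f j).

Definition graph_indicator (q w b : nat) (f : {ffun 'I_w -> 'I_b}) : grid q w b :=
  [ffun ij => (ij.2 == f ij.1)%:R].

Lemma coord_sumD (q w b : nat) (f : {ffun 'I_w -> 'I_b}) (x y : grid q w b) :
  coord_sum f (x + y) = coord_sum f x + coord_sum f y.
Proof.
by rewrite /coord_sum -big_split; apply: eq_bigr => j _; rewrite ffunE.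
Qed.

(** This lets the code control the translations: along its own word a sum moves by [w], along
    another codeword only by their agreement. *)
Lemma coord_sum_indicator (q w b : nat) (f g : {ffun 'I_w -> 'I_b}) :
  coord_sum f (graph_indicator q g) = (agree f g)%:R.
Proof.
rewrite /coord_sum /agree -sum1_card natr_sum [RHS]big_mkcond /=.
by apply: eq_bigr => j _; rewrite ffunE inE /=; case: eqP.
Qed.

(** [coord_sum f] is a homomorphism onto ['Z_q], so its fibres are translates of each other and have
    equal size. *)
Lemma card_coord_sum_lt (q w b L : nat) (f : {ffun 'I_w -> 'I_b}) :
  (0 < w)%N -> (1 < q)%N -> (L <= q)%N ->
  #|[set x : grid q w b | (coord_sum f x < L)%N]| = (L * q ^ (w * b).-1)%N.
Proof.
move=> w_gt0 q_gt1 le_Lq; have j0 := Ordinal w_gt0.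
pose fib (c : 'Z_q) := [set x : grid q w b | coord_sum f x == c].
have cardfib c : #|fib c| = #|fib 0|.
  pose d : grid q w b := [ffun ij => if ij == (j0, f j0) then c else 0].
  have sum_d : coord_sum f d = c.
    rewrite /coord_sum (bigD1 j0) //= ffunE eqxx big1 ?addr0 // => j ne_j.
    by rewrite ffunE xpair_eqE (negPf ne_j).
  rewrite -(card_imset (fib 0) (addIr d)); apply: eq_card => x; rewrite inE.
  apply/eqP/imsetP => [sum_x|[y]]; last first.
    by rewrite inE => /eqP sum_y ->; rewrite coord_sumD sum_y sum_d add0r.
  exists (x - d); last by rewrite subrK.
  rewrite inE; apply/eqP/(addIr c); rewrite add0r -[X in _ + X]sum_d.
  by rewrite -coord_sumD subrK.
have count K : (K <= q)%N ->
    #|[set x : grid q w b | (coord_sum f x < K)%N]| = (K * #|fib 0%R|)%N.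
  move=> le_Kq; rewrite -sum1_card.
  rewrite (partition_big (coord_sum f) (fun c => c < K)%N) /= => [|x]; last first.
    by rewrite inE.
  rewrite (eq_bigr (fun=> #|fib 0|)) => [|c lt_cK]; last first.
    rewrite -(cardfib c) -sum1_card; apply: eq_bigl => x; rewrite !inE.
    by case: eqP => [->|_]; rewrite ?lt_cK ?andbF.
  rewrite -(big_ord_widen _ (fun=> #|fib 0|)) ?Zp_cast //.
  by rewrite sum_nat_const card_ord.
have q_gt0 : (0 < q)%N by apply: ltn_trans q_gt1.
have wb_gt0 : (0 < w * b)%N.
  by rewrite muln_gt0 w_gt0 (leq_ltn_trans (leq0n (f j0))).
rewrite count //; congr (_ * _)%N; apply/eqP.
rewrite -(eqn_pmul2l q_gt0) -expnS prednK // -count //; apply/eqP.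
transitivity #|{: grid q w b}|.
  by apply: eq_card => x; rewrite inE -[X in (_ < X)%N](Zp_cast q_gt1) ltn_ord.
by rewrite card_ffun card_prod !card_ord Zp_cast.
Qed.

(* The [i]-th induced matching consists of the edges [(x, tau i x)] between two
   copies of [V], for [x \in P i].  The last clause makes
   the identity a perfect matching between the two copies none of whose edges
   joins [P i] to [tau i @: P i]. *)
Lemma ruzsa_szemeredi_exists (k u : nat) : (0 < k)%N -> (0 < u)%N ->
  exists (V I : finType) (P : I -> {set V}) (tau : I -> V -> V),
    let w := (k * u)%N in let b := (4 ^ k)%N in
    [/\ (2 ^ w <= #|I|)%N,
        #|V| = ((2 * w) ^ (w * b))%N,
        forall i, #|P i| = ((w - u) * (2 * w) ^ (w * b).-1)%N,
        forall i, injective (tau i) &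
        (forall i j x, x \in P i -> tau j x \in tau i @: P i -> j = i) /\
        (forall i x, x \in P i -> x \notin tau i @: P i)].
Proof.
move=> k_gt0 u_gt0; set w := (k * u)%N; set b := (4 ^ k)%N.
have w_gt0 : (0 < w)%N by rewrite muln_gt0 k_gt0.
have le_uw : (u <= w)%N by rewrite leq_pmull.
have b_gt0 : (0 < b)%N by rewrite expn_gt0.
have q_gt1 : (1 < 2 * w)%N by lia.
have [C [codeC sizeC]] := code_exists b_gt0 le_uw.
pose word (i : 'I_#|C|) : {ffun 'I_w -> 'I_b} := enum_val i.
pose P i := [set x : grid (2 * w) w b | (coord_sum (word i) x < w - u)%N].
pose tau i (x : grid (2 * w) w b) := x + graph_indicator _ (word i).
(* No wrap-around: a sum below [w - u] stays below the period [2 * w] after adding [w]. *)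
have imP i y : y \in tau i @: P i -> (w <= coord_sum (word i) y)%N.
  case/imsetP => x; rewrite inE => Px ->.
  rewrite coord_sumD coord_sum_indicator agreexx val_ZpD // modn_small; lia.
exists (grid (2 * w) w b), 'I_#|C|, P, tau; split.
(* The alphabet size [4 ^ k] gives [b ^ u = 4 ^ w], so dividing by [2 ^ w] leaves at least [2 ^ w]
   codewords. *)
- have : (2 ^ w * 2 ^ w <= #|C| * 2 ^ w)%N.
    by apply: leq_trans sizeC; rewrite -expnMn -expnM.
  by rewrite leq_pmul2r ?expn_gt0 // card_ord.
- by rewrite card_ffun card_prod !card_ord Zp_cast.
- by move=> i; rewrite card_coord_sum_lt //; lia.
- by move=> i; apply: addIr.
split=> [i j x|i x]; rewrite inE => Px; last first.
  by apply/negP => /imP; lia.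
(* Along another codeword a sum below [w - u] moves by less than [u], so it stays below [w] and
   misses the image of [P i]. *)
move/imP; rewrite coord_sumD coord_sum_indicator val_ZpD //.
case: (eqVneq j i) => // ne_ji.
have lt_u : (agree (word i) (word j) < u)%N.
  apply: codeC; rewrite ?enum_valP //.
  by apply: contra_neq ne_ji => /enum_val_inj.
by rewrite modn_small; lia.
Qed.

(** * Exponential-moment lower bound on the memory *)

(** A random [m]-subset of an [r]-set avoids [h] given points with probability at most
    [(1 - h / r) ^ m]; denominators are cleared and falling factorials compared factor by factor. *)
Lemma bin_avoid_le (m r h : nat) :
  ('C(r - h, m) * r ^ m <= 'C(r, m) * (r - h) ^ m)%N.
Proof.
have ff : ((r - h) ^_ m * r ^ m <= r ^_ m * (r - h) ^ m)%N.
  elim: m => [|m IH] //; rewrite !ffactnSr !expnS.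
  have step : ((r - h - m) * r <= (r - m) * (r - h))%N by nia.
  have := leq_mul IH step.
  by rewrite (mulnACA _ _ (_ - m)%N) [(r ^ m * r)%N]mulnC
             [X in (_ <= X)%N]mulnACA [((r - h) ^ m * _)%N]mulnC.
rewrite -(leq_pmul2r (fact_gt0 m)) -!mulnA ![(_ ^ m * m`!)%N]mulnC !mulnA.
by rewrite !bin_ffact.
Qed.

Lemma bin_avoid_expR (R : realType) (m r h : nat) : (h <= r)%N ->
  'C(r - h, m)%:R * expR (m%:R * h%:R / r%:R) <= 'C(r, m)%:R :> R.
Proof.
move=> le_hr; have [->|r_gt0] := posnP r.
  by rewrite sub0n invr0 mulr0 expR0 mulr1.
have r0 : (0 : R) < r%:R by rewrite ltr0n.
have le1 : (1 - h%:R / r%:R) ^+ m <= expR (- (m%:R * h%:R / r%:R)) :> R.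
  rewrite -mulrA -[X in expR X]mulrN expRM_natl.
  apply: lerXn2r; rewrite ?nnegrE ?expR_ge0 //.
    by rewrite subr_ge0 ler_pdivrMr // mul1r ler_nat.
  exact: expR_ge1Dx.
rewrite -ler_pdivlMr ?expR_gt0 // -expRN.
apply: le_trans (ler_wpM2l _ le1); last by rewrite ler0n.
have -> : 1 - h%:R / r%:R = (r%:R - h%:R) / r%:R :> R.
  by rewrite mulrBl divff ?lt0r_neq0.
rewrite expr_div_n mulrA.
rewrite ler_pdivlMr ?exprn_gt0 // -natrB // -!natrX -!natrM ler_nat.
exact: bin_avoid_le.
Qed.

(* Chernoff: for a fixed memory state the events of success at the different
   indices are independent and have probability at most [exp (- m h / r)], so
   the exponential moment of the number of successes is at most [2 ^ #|I|];
   summing over the memory states removes the dependence of the state on the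
   input. *)
Lemma memory_lower_bound (R : realType) (V I Mem : finType) (m r h : nat)
    (P : I -> {set V}) (mem : {ffun I -> {set V}} -> Mem)
    (F : Mem -> I -> {set V}) (p : R) :
  (m <= r)%N -> (h <= r)%N -> (forall i, #|P i| = r) ->
  let X := family (fun i => [pred A : {set V} | (A \subset P i) && (#|A| == m)]) in
  p * #|X|%:R * #|I|%:R <=
    (\sum_(D in X) \sum_i
       [&& F (mem D) i \subset P i :\: D i & (h <= #|F (mem D) i|)%N])%:R ->
  p * #|I|%:R * (m%:R * h%:R / r%:R) <= ln #|Mem|%:R + #|I|%:R.
Proof.
move=> le_mr le_hr cardP X.
set lam := m%:R * h%:R / r%:R.
pose succ mu i (A : {set V}) := (F mu i \subset P i :\: A) && (h <= #|F mu i|)%N.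
pose z mu (D : {ffun I -> {set V}}) := (\sum_i succ mu i (D i))%N.
move=> avg.
pose Xi i := [pred A : {set V} | (A \subset P i) && (#|A| == m)].
have cardXi i : #|Xi i| = 'C(r, m).
  by rewrite -(cardP i) -cards_draws; apply: eq_card => A; rewrite !inE.
have cardX : #|X| = ('C(r, m) ^ #|I|)%N.
  rewrite /X card_family foldrE big_map big_enum /=.
  rewrite (eq_bigr (fun=> 'C(r, m))) ?prod_nat_const // => i _.
  exact: cardXi.
have X_gt0 : 0 < #|X|%:R :> R by rewrite ltr0n cardX expn_gt0 bin_gt0 le_mr.
(* [lam] is tuned so that the weight [exp lam] of a success is offset by its probability; successes
   and failures each contribute at most ['C(r, m)]. *)
have one mu i :
    \sum_(A in Xi i) expR (lam * (succ mu i A)%:R) <= 2 * 'C(r, m)%:R.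
  rewrite (bigID (succ mu i)) /= mulr2n mulrDl mul1r; apply: lerD; last first.
    rewrite (eq_bigr (fun=> 1)) => [|A /andP[_ /negPf ->]]; last first.
      by rewrite mulr0 expR0.
    rewrite sumr_const -(cardXi i) ler_nat; apply: subset_leq_card.
    by apply/subsetP => A /andP[].
  have [leF|ltF] := leqP h #|F mu i|; last first.
    by rewrite big_pred0 ?ler0n // => A; rewrite /succ leqNgt ltF !andbF.
  have [sF|nsF] := boolP (F mu i \subset P i); last first.
    rewrite big_pred0 ?ler0n // => A; rewrite /succ.
    by rewrite subsetD (negPf nsF) andbF.
  rewrite (eq_bigr (fun=> expR lam)) => [|A /andP[_ ->]]; last by rewrite mulr1.
  rewrite sumr_const -[X in X <= _]mulr_natl.
  apply: (le_trans _ (bin_avoid_expR R m le_hr)).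
  rewrite ler_wpM2r ?expR_ge0 // ler_nat.
  apply: (@leq_trans 'C(r - #|F mu i|, m)); last exact/leq_bin2l/leq_sub2l.
  rewrite -(cardP i) -(setIidPr sF) -cardsD -cards_draws.
  apply: subset_leq_card; apply/subsetP => A.
  rewrite !inE /succ => /andP[/andP[sA ->]] /andP[sFA _]; rewrite andbT.
  rewrite subsetD sA; rewrite subsetD in sFA.
  by case/andP: sFA => _; rewrite disjoint_sym.
have fixed mu : \sum_(D in X) expR (lam * (z mu D)%:R) <= 2 ^+ #|I| * #|X|%:R.
  rewrite cardX natrX -exprMn.
  rewrite (eq_bigr (fun D : {ffun I -> {set V}} =>
             \prod_i expR (lam * (succ mu i (D i))%:R))) => [|D _]; last first.
    by rewrite -expR_sum -mulr_sumr natr_sum.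
  rewrite /X -(bigA_distr_big_dep _ (fun i A => expR (lam * (succ mu i A)%:R))).
  rewrite -prodr_const; apply: ler_prod => i _; rewrite one andbT.
  by apply: sumr_ge0 => A _; apply: expR_ge0.
have upper : \sum_(D in X) expR (lam * (z (mem D) D)%:R)
    <= #|Mem|%:R * (2 ^+ #|I| * #|X|%:R).
  apply: (@le_trans _ _ (\sum_mu \sum_(D in X) expR (lam * (z mu D)%:R))).
    rewrite exchange_big; apply: ler_sum => D _; rewrite (bigD1 (mem D)) //=.
    by rewrite lerDl; apply: sumr_ge0 => mu _; apply: expR_ge0.
  rewrite mulr_natl -sumr_const; apply: ler_sum => mu _; exact: fixed.
have lam_ge0 : 0 <= lam by rewrite divr_ge0 ?mulr_ge0 ?ler0n.
(* Jensen's inequality for [exp], through its tangent at [p * #|I|]. *)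
have lower : expR (lam * (p * #|I|%:R)) * #|X|%:R <=
    \sum_(D in X) expR (lam * (z (mem D) D)%:R).
  pose y := p * #|I|%:R.
  apply: (@le_trans _ _ (\sum_(D in X)
      expR (lam * y) * (1 + lam * ((z (mem D) D)%:R - y)))).
    rewrite -mulr_sumr ler_wpM2l ?expR_ge0 // big_split /= sumr_const.
    rewrite lerDl -mulr_sumr mulr_ge0 // sumrB sumr_const subr_ge0.
    rewrite -natr_sum -[X in X <= _]mulr_natr /y mulrAC; exact: avg.
  apply: ler_sum => D _.
  rewrite [X in _ <= expR X](_ : _ = lam * y + lam * ((z (mem D) D)%:R - y)).
    by rewrite expRD ler_wpM2l ?expR_ge0 // expR_ge1Dx.
  by rewrite -mulrDr addrC subrK.
have := le_trans lower upper; rewrite mulrA ler_pM2r // => le2.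
have Mem_gt0 : 0 < #|Mem|%:R :> R.
  rewrite lt0r ler0n andbT; apply/negP => /eqP M0.
  by move: le2; rewrite M0 mul0r leNgt expR_gt0.
(* Compare exponentials, weakening [2 ^ #|I|] to [exp #|I|]. *)
rewrite mulrC -ler_expR; apply: (le_trans le2); rewrite expRD lnK //.
rewrite ler_wpM2l ?ler0n // -[X in expR X]mulr1 expRM_natl.
apply: lerXn2r; rewrite ?nnegrE ?expR_ge0 //.
by rewrite (le_trans _ (expR_ge1Dx 1)).
Qed.

(** * Matchings and Greedy *)

Lemma matchingP (n : nat) (M : {set edge n}) :
  reflect ({in M &, injective fst} /\ {in M &, injective snd}) (matching M).
Proof.
apply: (iffP forall_inP) => [matM|[inj1 inj2] e eM].
  by split=> e f eM fM ef; apply: contraTeq (forall_inP (matM e eM) f fM) => ne_ef;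
    rewrite ne_ef ef eqxx ?andbF.
apply/forall_inP => f fM; apply/implyP => ne_ef.
by apply/andP; split; apply: contra_neq ne_ef => ?; [apply: inj1|apply: inj2].
Qed.

Lemma matching_sub (n : nat) (M N : {set edge n}) :
  M \subset N -> matching N -> matching M.
Proof.
move=> /subsetP sMN /matchingP[inj1 inj2]; apply/matchingP.
by split=> e f /sMN eN /sMN fN; [apply: inj1|apply: inj2].
Qed.

(** Subsets of a matching are matchings, so Greedy accepts all of [s1]; each later edge meets [s1]
    and changes nothing. *)
Lemma greedy_cat_maximal (n : nat) (s1 s2 : seq (edge n)) :
  matching [set e in s1] ->
  (forall e, e \in s2 -> exists2 f, f \in s1 & (e.1 == f.1) || (e.2 == f.2)) ->
  greedy (s1 ++ s2) = [set e in s1].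
Proof.
move=> mat1 block; rewrite /greedy foldl_cat.
have -> (M : {set edge n}) : matching (M :|: [set e in s1]) ->
    foldl (fun M e => if matching (e |: M) then e |: M else M) M s1
      = M :|: [set e in s1].
  elim: s1 M {mat1 block} => [|e s1 IH] M mat /=; first by rewrite set_nil setU0.
  rewrite set_cons setUCA setUA in mat *.
  by rewrite (matching_sub _ mat) ?subsetUl // IH.
- rewrite set0U; elim: s2 block => [|e s2 IH] //= block.
  case: ifP => mat; last by apply: IH => f fs2; apply: block; rewrite inE fs2 orbT.
  (* The test passes a blocked edge only if it is already in the matching, and adding it again has
     no effect. *)
  suff eM : e \in [set f in s1].
    rewrite (setUidPr _) ?sub1set //.
    by apply: IH => f fs2; apply: block; rewrite inE fs2 orbT.
  have [f fs1 ef] := block e (mem_head _ _); rewrite inE.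
  case/matchingP: mat => inj1 inj2.
  have eS : e \in e |: [set f in s1] by rewrite setU11.
  have fS : f \in e |: [set f in s1] by rewrite !inE fs1 orbT.
  by case/orP: ef => /eqP ef; [rewrite (inj1 _ _ eS fS ef)|rewrite (inj2 _ _ eS fS ef)].
by rewrite set0U.
Qed.

(** * The hard instances and their matchings *)

Section HardInstance.

Variables (n : nat) (V I : finType) (P : I -> {set V}) (tau : I -> V -> V).
(* [e s o x] is the copy of [x] on the left if [s], on the right otherwise; it
   is an old vertex (of the Ruzsa-Szemeredi graph) if [o] and a new one
   otherwise. *)
Variable e : bool -> bool -> V -> 'I_n.
Hypothesis e_inj : forall s o x s' o' x',
  e s o x = e s' o' x' -> [/\ s = s', o = o' & x = x'].
Hypothesis tau_inj : forall i, injective (tau i).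
Hypothesis tau_induced :
  forall i j x, x \in P i -> tau j x \in tau i @: P i -> j = i.
Hypothesis tau_disjoint : forall i x, x \in P i -> x \notin tau i @: P i.

(** Independent of [D] and [i], so being told the vertex class reveals nothing about them. *)
Definition hard_side : {set 'I_n} := [set v | [exists o, exists x, v == e true o x]].

Definition base_edge (x : V) : edge n := (e true true x, e false true x).
Definition hidden_edge (i : I) (x : V) : edge n :=
  (e true true x, e false true (tau i x)).
Definition left_edge (x : V) : edge n := (e true true x, e false false x).
Definition right_edge (y : V) : edge n := (e true false y, e false true y).

Definition base_edges : {set edge n} := base_edge @: [set: V].
(** A one-way communication game: Alice knows the removed sets [D], Bob the index [i], and the
    memory is the message. *)
Definition alice_edges (D : {ffun I -> {set V}}) : {set edge n} :=
  \bigcup_i hidden_edge i @: (P i :\: D i).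
Definition bob_edges (i : I) : {set edge n} :=
  left_edge @: (~: P i) :|: right_edge @: (~: (tau i @: P i)).
Definition hard_edges (D : {ffun I -> {set V}}) (i : I) : {set edge n} :=
  base_edges :|: (alice_edges D :|: bob_edges i).

Lemma mem_hard_side s o x : (e s o x \in hard_side) = s.
Proof.
rewrite inE; apply/existsP/idP => [[b' /existsP[x' /eqP/e_inj[-> _ _]]]|->] //.
by exists o; apply/existsP; exists x.
Qed.

Lemma hard_edgesP D i f : f \in hard_edges D i ->
  [\/ exists x, f = base_edge x,
      exists j x, [/\ x \in P j, x \notin D j & f = hidden_edge j x],
      exists2 x, x \notin P i & f = left_edge x |
      exists2 y, y \notin tau i @: P i & f = right_edge y].
Proof.
case/setUP => [/imsetP[x _ ->]|/setUP[/bigcupP[j _ /imsetP[x]]|]].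
- by constructor 1; exists x.
- by case/setDP => xP xD ->; constructor 2; exists j, x.
case/setUP => /imsetP[x]; rewrite in_setC => xP ->.
  by constructor 3; exists x.
by constructor 4; exists x.
Qed.

Lemma hard_edges_bip D i : hard_edges D i \subset setX hard_side (~: hard_side).
Proof.
apply/subsetP => f /hard_edgesP[] => [[x ->]|[j [x [_ _ ->]]]|[x _ ->]|[y _ ->]];
  by rewrite in_setX in_setC !mem_hard_side.
Qed.

Definition hard_graph D i : bigraph n := BiGraph (hard_edges_bip D i).

Definition hard_stream D i : seq (edge n) :=
  enum base_edges ++ enum (alice_edges D) ++ enum (bob_edges i).

(** A coincidence would give [tau j x = x], a point of both [P j] and its image. *)
Lemma hidden_not_base j x y : x \in P j -> base_edge y <> hidden_edge j x.
Proof.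
move=> xP [/e_inj[_ _ ->] /e_inj[_ _ tx]].
by move: (tau_disjoint xP); rewrite {1}tx imset_f.
Qed.

Lemma hard_stream_of D i : stream_of (hard_graph D i) (hard_stream D i).
Proof.
apply: uniq_perm; rewrite ?enum_uniq //; last first.
  by move=> f; rewrite !mem_cat !mem_enum !in_setU.
rewrite !cat_uniq !enum_uniq /= andbT; apply/andP; split.
  apply/hasPn => f; rewrite mem_cat !mem_enum => fS.
  apply/negP => /imsetP[x _ fE]; move: fS; rewrite fE.
  case/orP => [/bigcupP[j _ /imsetP[y /setDP[yP _] /(hidden_not_base yP)]] //|].
  by case/setUP => /imsetP[y _ []] /e_inj[_ // _ _] /e_inj[].
apply/hasPn => f; rewrite !mem_enum => fS.
apply/negP => /bigcupP[j _ /imsetP[x _ fE]]; move: fS; rewrite fE.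
by case/setUP => /imsetP[y _ []] /e_inj[_ // _ _] /e_inj[].
Qed.

(** The base edges cover all old vertices, and every edge of the graph has an old endpoint. *)
Lemma greedy_hard_stream D i : greedy (hard_stream D i) = base_edges.
Proof.
rewrite /hard_stream greedy_cat_maximal.
- by apply/setP => f; rewrite inE mem_enum.
- apply/matchingP; split=> f g; rewrite !inE !mem_enum;
  by move=> /imsetP[x _ ->] /imsetP[y _ ->] /e_inj[_ _ ->].
have baseE y : base_edge y \in enum base_edges by rewrite mem_enum imset_f.
move=> f; rewrite mem_cat !mem_enum.
case/orP => [/bigcupP[j _ /imsetP[x _ ->]]|/setUP[]/imsetP[x _ ->]].
- by exists (base_edge x); rewrite ?eqxx.
- by exists (base_edge x); rewrite ?eqxx.
- by exists (base_edge x); rewrite ?eqxx ?orbT.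
Qed.

Definition revealed (M : {set edge n}) (i : I) : {set V} :=
  [set x in P i | hidden_edge i x \in M].

(** An output edge [hidden_edge i x] is in the graph, and by inducedness no other matching can
    supply it, so [x] was not removed. *)
Lemma revealed_sub D i M :
  matching_of (hard_graph D i) M -> revealed M i \subset P i :\: D i.
Proof.
case/andP => /subsetP sM _; apply/subsetP => x; rewrite inE => /andP[xP xM].
rewrite inE xP andbT; case: (hard_edgesP (sM _ xM)).
- by case=> y /esym/(hidden_not_base xP).
- case=> j [y [yP yD []]] /e_inj[_ _ xy] /e_inj[_ _ txy]; rewrite {}xy in txy xP *.
  suff <- : j = i by [].
  by apply: (tau_induced xP); rewrite -txy imset_f.
- by case=> y _ [_ /e_inj[]].
- by case=> y _ [/e_inj[]].
Qed.

(* Without the edges of the [i]-th induced matching the old vertices outside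
   [P i] and [tau i @: P i] form a vertex cover. *)
Lemma card_matching_hard D i M : matching_of (hard_graph D i) M ->
  (#|M| <= 2 * (#|V| - #|P i|) + #|revealed M i|)%N.
Proof.
case/andP => /subsetP sM /matchingP[inj1 inj2].
pose M1 := [set f in M | f.1 \in e true true @: ~: P i].
pose M2 := [set f in M | f.2 \in e false true @: ~: (tau i @: P i)].
have cover : M \subset M1 :|: M2 :|: hidden_edge i @: revealed M i.
  apply/subsetP => f fM; rewrite !in_setU !inE fM /=.
  have [//|f1 /=] := boolP (f.1 \in _); have [//|f2 /=] := boolP (f.2 \in _).
  case: (hard_edgesP (sM _ fM)).
  - case=> x fE; rewrite fE /= in f1 f2.
    have xP : x \in P i.
      by apply: contraR f1 => xP; rewrite imset_f // in_setC.
    by case/negP: f2; rewrite imset_f // in_setC tau_disjoint.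
  - case=> j [x [_ _ fE]]; rewrite fE /= in f1 f2 fM *.
    have xP : x \in P i.
      by apply: contraR f1 => xP; rewrite imset_f // in_setC.
    have txP : tau j x \in tau i @: P i.
      by apply: contraR f2 => txP; rewrite imset_f // in_setC.
    have ji := tau_induced xP txP; rewrite ji in fM *.
    by rewrite imset_f // inE xP.
  - by case=> x xP fE; case/negP: f1; rewrite fE /= imset_f // in_setC.
  - by case=> y yP fE; case/negP: f2; rewrite fE /= imset_f // in_setC.
have card1 : (#|M1| <= #|V| - #|P i|)%N.
  rewrite -(card_in_imset (f := fst) (D := M1)); last first.
    by move=> f g; rewrite !inE => /andP[fM _] /andP[gM _]; apply: inj1.
  apply: (@leq_trans #|e true true @: ~: P i|).
    apply: subset_leq_card; apply/subsetP => v /imsetP[f].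
    by rewrite inE => /andP[_ fP] ->.
  by rewrite (leq_trans (leq_imset_card _ _)) // cardsCs setCK.
have card2 : (#|M2| <= #|V| - #|P i|)%N.
  rewrite -(card_in_imset (f := snd) (D := M2)); last first.
    by move=> f g; rewrite !inE => /andP[fM _] /andP[gM _]; apply: inj2.
  apply: (@leq_trans #|e false true @: ~: (tau i @: P i)|).
    apply: subset_leq_card; apply/subsetP => v /imsetP[f].
    by rewrite inE => /andP[_ fP] ->.
  by rewrite (leq_trans (leq_imset_card _ _)) // cardsCs setCK card_imset.
apply: leq_trans (subset_leq_card cover) _.
apply: leq_trans (leq_card_setU _ _) _; apply: leq_add (leq_imset_card _ _).
apply: leq_trans (leq_card_setU _ _) _; rewrite mul2n -addnn.
exact: leq_add.
Qed.

(** The witness matches the old left vertices of [P i :\: D i] by hidden edges, those outside [P i]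
    to new vertices, and the old right vertices outside [tau i @: P i] to new vertices. *)
Lemma mu_hard_graph (D : {ffun I -> {set V}}) i : D i \subset P i ->
  (#|V| - #|D i| + (#|V| - #|P i|) <= mu (hard_graph D i))%N.
Proof.
move=> sDP.
(* Edges are indexed by their left endpoints, old for [inl] and new for [inr]; right endpoints
   differ only within [S], where right edges avoid [tau i @: P i]. *)
pose h (z : V + V) : edge n := match z with
  | inl x => if x \in P i then hidden_edge i x else left_edge x
  | inr y => right_edge y end.
pose S := [set inl x | x in ~: D i] :|: [set inr y | y in ~: (tau i @: P i)].
have inS1 (x : V) : (inl x \in S) = (x \notin D i).
  rewrite in_setU mem_imset ?in_setC; last by move=> ? ? [].
  by case: imsetP => [[]//|_]; rewrite orbF.
have inS2 (y : V) : (inr y \in S) = (y \notin tau i @: P i).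
  rewrite in_setU (mem_imset _ _ (f := inr)) ?in_setC; last by move=> ? ? [].
  by case: imsetP => [[]//|_].
have inj1 : injective (fst \o h).
  move=> [x|x] [y|y] /=; rewrite ?(fun_if fst) ?if_same => /e_inj[_ o ->] //.
have inj2 : {in S &, injective (snd \o h)}.
  move=> [x|x] [y|y]; rewrite ?inS1 ?inS2 /= ?(fun_if snd) => xS yS.
  - case: ifP => xP; case: ifP => yP => /e_inj[_ // _].
      by move/tau_inj => ->.
    by move=> ->.
  - case: ifP => xP => /e_inj[_ // _ txy].
    by move: yS; rewrite -txy imset_f.
  - case: ifP => yP => /e_inj[_ // _ txy].
    by move: xS; rewrite txy imset_f.
  - by move=> /e_inj[_ _ ->].
have inj_h : injective h by move=> x y hxy; apply: inj1; rewrite /= hxy.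
have hS : matching_of (hard_graph D i) (h @: S).
  apply/andP; split; last first.
    apply/matchingP; split=> f g /imsetP[x xS ->] /imsetP[y yS ->] fg.
      by rewrite (inj1 x y fg).
    by rewrite (inj2 x y xS yS fg).
  apply/subsetP => f /imsetP[[x|x]]; rewrite ?inS1 ?inS2 => xS -> /=.
    rewrite !in_setU; case: ifP => xP.
      apply/orP; right; apply/orP; left; apply/bigcupP; exists i => //.
      by rewrite imset_f // inE xS.
    by rewrite (imset_f left_edge) ?orbT // in_setC xP.
  by rewrite !in_setU (imset_f right_edge) ?orbT // in_setC.
have cardS : #|S| = (#|V| - #|D i| + (#|V| - #|P i|))%N.
  rewrite cardsU [X in (_ - #|pred_of_set X|)%N](_ : _ = set0); last first.
    by apply/setP => z; rewrite !inE; apply/negP => /andP[/imsetP[x _ ->] /imsetP[]].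
  rewrite cards0 subn0 !card_imset; try by move=> ? ? [].
  by rewrite [X in (X + _)%N]cardsCs [X in (_ + X)%N]cardsCs !setCK card_imset.
rewrite -cardS -(card_imset _ inj_h).
exact: (leq_bigmax_cond (F := fun M : {set edge n} => #|M|) _ hS).
Qed.

(** The second pass always starts from [enc base_edges], so the state before Bob's edges depends on
    [D] alone and the output on that state and [i]. *)
Lemma run_hard_stream (s : nat) (a : two_pass n s) : greedy_first_pass a ->
  exists (mem : {ffun I -> {set V}} -> s.-tuple bool)
         (out : s.-tuple bool -> I -> {set edge n}),
    forall D i, run a hard_side (hard_stream D i) = out (mem D) i.
Proof.
move=> /(_ hard_side)[enc [_ first]].
pose step := tp_step2 a hard_side.
exists (fun D => foldl step (enc base_edges)
          (enum base_edges ++ enum (alice_edges D))).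
exists (fun c i => tp_output a hard_side (foldl step c (enum (bob_edges i)))).
move=> D i; rewrite /run (first (hard_graph D i)) ?hard_stream_of //.
by rewrite greedy_hard_stream /hard_stream catA foldl_cat.
Qed.

End HardInstance.

(** * Fixing the seed and bounding the space *)

(** The expected number of events that occur is at least [p * size s], so some outcome reaches it.
    This fixes a seed that is good on average over the instances. *)
Lemma average_outcome (R : realType) (d : measure_display)
    (Omega : measurableType d) (mu : probability Omega R) (J : eqType)
    (s : seq J) (A : J -> set Omega) (p : R) :
  (forall j, measurable (A j)) ->
  (forall j, j \in s -> (p%:E <= mu (A j))%E) ->
  exists w, p * (size s)%:R <= (\sum_(j <- s) (w \in A j))%:R.
Proof.
move=> mA pA; pose c w := (\sum_(j <- s) (w \in A j))%N.
have [w0 _] : exists w0 : Omega, True.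
  apply/not_existsP => noO.
  have := probability_setT mu; rewrite (_ : classical_sets.setT = classical_sets.set0).
    by rewrite measure0 => /eqP; rewrite eqe eq_sym oner_eq0.
  by apply/classical_sets.seteqP; split=> w _; case: (noO w).
(* The count takes finitely many values; its maximum is attained and bounds the expectation. *)
have exK : exists k, `[< exists w, c w = k >] by exists (c w0); apply/asboolP; exists w0.
have ubK k : `[< exists w, c w = k >] -> (k <= size s)%N.
  move=> /asboolP[w <-]; rewrite /c -sum1_size; apply: leq_sum => j _.
  exact: leq_b1.
case: (ex_maxnP exK ubK) => K /asboolP[w cw] maxK; exists w.
rewrite -/(c w) cw -lee_fin.
have meas j : measurable_fun [set: Omega]%classic (EFin \o (\1_(A j) : Omega -> R)).
  by apply/measurable_EFinP; apply: measurable_indic.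
apply: (@le_trans _ _ (\sum_(j <- s) mu (A j))%E).
  rewrite -[s]map_id big_map size_map.
  rewrite (_ : (p * (size s)%:R)%:E = (\sum_(j <- s) p%:E)%E).
    by rewrite [leLHS]big_seq [leRHS]big_seq; apply: lee_sum => j; apply: pA.
  by rewrite sumEFin big_const_seq count_predT iter_addr_0 mulr_natr.
rewrite (eq_bigr (fun j => (\int[mu]_(x in [set: Omega]%classic) (\1_(A j) x)%:E)%E)) => [|j _].
  rewrite -ge0_integral_sum //.
  apply: (@le_trans _ _ (\int[mu]_(x in [set: Omega]%classic) cst (K%:R)%:E x)%E).
    apply: ge0_le_integral => //.
    - by move=> x _; apply: sume_ge0 => j _; rewrite lee_fin.
    - exact: emeasurable_sum.
    move=> x _ /=; rewrite sumEFin lee_fin.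
    rewrite (_ : \sum_(j <- s) \1_(A j) x = (c x)%:R) ?ler_nat.
      by apply: maxK; apply/asboolP; exists x.
    by rewrite /c natr_sum; apply: eq_bigr.
  by rewrite integral_cst //= -[leRHS]mule1 -(probability_setT mu).
by rewrite integral_indic // classical_sets.setIT.
Qed.

(** In units of [x], [N = 2 * k * x], [#|P i| = (k - 1) * x] and [#|D i| = m <= x]. So the optimum
    is at least [3 * k * x], and a good output has at least [(2 * k + 6) * x] edges as
    [eps >= 2 / k]. At most [2 * (k + 1) * x] of them avoid the [i]-th matching, so more than
    [2 * x] are revealed. *)
Lemma space_bound (R : realType) (eps p : R) (k u n s : nat)
    (d : measure_display) (Omega : measurableType d) (Pr : probability Omega R)
    (a : rand_two_pass Omega n s) :
  (2 < k)%N -> (0 < u)%N -> 2 / k%:R <= eps ->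
  let w := (k * u)%N in let N := ((2 * w) ^ (w * 4 ^ k))%N in
  (4 * N <= n)%N ->
  (forall w : Omega, greedy_first_pass (a w)) ->
  approximates Pr a (2 / 3 + eps) p ->
  exists2 K, (2 ^ w <= K)%N &
    p * K%:R * (N%:R / k%:R ^+ 2) <= s%:R + K%:R.
Proof.
move=> k_gt2 u_gt0 le_eps w N le_n ga aa.
have k_gt0 : (0 < k)%N by lia.
have [V [I [P [tau [leI cardV cardP tau_inj [tau_ind tau_dis]]]]]] :=
  ruzsa_szemeredi_exists k_gt0 u_gt0.
rewrite -/w -/N in leI cardV cardP.
exists #|I| => //.
pose N1 := ((2 * w) ^ (w * 4 ^ k).-1)%N.
have N_eq : N = (2 * w * N1)%N.
  by rewrite -expnS prednK // muln_gt0 expn_gt0 /w muln_gt0 k_gt0 u_gt0.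
pose x := (u * N1)%N; pose r := ((w - u) * N1)%N; pose m := (r %/ k)%N.
have r_eq : r = ((k - 1) * x)%N by rewrite /r /x [RHS]mulnA [in RHS]mulnBl mul1n.
(* The division is exact: [k] divides [w], hence [N1], whose exponent is positive. *)
have m_eq : (m * k)%N = r.
  rewrite divnK // dvdn_mull // dvdn_exp //;
    last by rewrite dvdn_mull // dvdn_mulr.
  have : (4 * 1 <= w * 4 ^ k)%N.
    rewrite mulnC leq_mul ?muln_gt0 ?k_gt0 //.
    by rewrite -[X in (X <= _)%N]expn1 leq_exp2l.
  by lia.
have le_mx : (m <= x)%N.
  by rewrite -(leq_pmul2r k_gt0) m_eq r_eq mulnC leq_mul2l leq_subr orbT.
have NE : N = (2 * k * x)%N by rewrite N_eq /x /w; ring.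
have le_V : (#|{: bool * bool * V}| <= n)%N.
  by rewrite !card_prod card_bool cardV.
pose e b o y : 'I_n := widen_ord le_V (enum_rank (b, o, y)).
have e_inj b o y b' o' y' : e b o y = e b' o' y' -> [/\ b = b', o = o' & y = y'].
  by move=> /(congr1 val) /= /val_inj /enum_rank_inj [-> -> ->].
pose X := family (fun i => [pred A : {set V} | (A \subset P i) && (#|A| == m)]).
pose hs := hard_side e; pose G D i := hard_graph P tau e_inj D i.
pose st D i := hard_stream P tau e D i.
pose good D i M := matching_of (G D i) M &&
  ((2 / 3 + eps) * (Defs.mu (G D i))%:R <= #|M|%:R).
pose J := [seq (D, i) | D <- enum X, i <- enum I].
pose ev (z : {ffun I -> {set V}} * I) :=
  [set o | good z.1 z.2 (run (a o) hs (st z.1 z.2))]%classic.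
(* The event is a finite union over the good outputs. *)
have m_ev z : measurable (ev z).
  rewrite (_ : ev z = \bigcup_(M in [set M | good z.1 z.2 M])
      [set o | run (a o) hs (st z.1 z.2) = M])%classic.
    by apply: fin_bigcup_measurable => [|M _]; [exact: finite_finset|exact: rtp_meas].
  apply/classical_sets.seteqP; split=> [t gt|t [M gM /= eM]]; last first.
    by rewrite /ev /= eM.
  by exists (run (a t) hs (st z.1 z.2)).
have p_ev z : z \in J -> (p%:E <= Pr (ev z))%E.
  move=> _; have le_p := aa _ _ (hard_stream_of e_inj tau_dis z.1 z.2).
  apply: (le_trans le_p).
  rewrite le_eqVlt; apply/orP; left; apply/eqP; congr (Pr _).
  by apply/classical_sets.seteqP; split=> o; [move=> [] *; apply/andP|move/andP].
have [t] := average_outcome m_ev p_ev.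
rewrite size_allpairs -!cardE big_allpairs big_enum /=.
have [mem [out run_eq]] := run_hard_stream e_inj tau_dis (ga t).
pose F c i := revealed P tau e (out c i) i.
move=> avg.
have le_h : (2 * x <= r)%N by rewrite r_eq leq_mul2r; apply/orP; right; lia.
have le_mr : (m <= r)%N by rewrite leq_div.
have x_gt0 : (0 < x)%N.
  by rewrite muln_gt0 u_gt0 expn_gt0 muln_gt0 /= /w muln_gt0 k_gt0 u_gt0.
clearbody x; have le_xk : (x <= k * x)%N by rewrite leq_pmull.
have reveals D i : D \in X -> good D i (out (mem D) i) ->
    [&& F (mem D) i \subset P i :\: D i & (2 * x <= #|F (mem D) i|)%N].
  move=> /familyP/(_ i)/andP[sDP /eqP cardD] /andP[mat big].
  rewrite (revealed_sub tau_ind tau_dis mat) /=.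
  have ub := card_matching_hard tau_inj tau_ind tau_dis mat.
  have lb := mu_hard_graph e_inj tau_inj sDP.
  rewrite -/(F (mem D) i) in ub; rewrite cardD in lb.
  rewrite !cardV !cardP -/N1 -/r in ub lb.
  have lb3 : (3 * k * x <= Defs.mu (G D i))%N.
    apply: leq_trans lb; rewrite NE r_eq mulnBl mul1n -!mulnA.
    by move: le_mx le_xk; lia.
  have ub3 : (#|out (mem D) i| <= 2 * (k + 1) * x + #|F (mem D) i|)%N.
    apply: (leq_trans ub); rewrite NE r_eq mulnBl mul1n mulnDr mulnDl -!mulnA.
    by move: le_xk; lia.
  have k0 : 0 < k%:R :> R by rewrite ltr0n.
  have x0 : 0 < x%:R :> R by rewrite ltr0n.
  have eps_k : 2 <= eps * k%:R by rewrite -ler_pdivrMr.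
  rewrite -(ler_nat R) in lb3; rewrite -(ler_nat R) in ub3; rewrite -(ler_nat R).
  rewrite natrD !natrM natrD in ub3; rewrite !natrM in lb3 *.
  have eps0 : 0 <= eps by rewrite (le_trans _ le_eps) // divr_ge0 ?ler0n.
  have rho0 : 0 <= 2 / 3 + eps by lra.
  have eps_kx : 2 * x%:R <= eps * k%:R * x%:R by rewrite ler_wpM2r ?ler0n.
  have := le_trans (ler_wpM2l rho0 lb3) (le_trans big ub3). lra.
have step := @memory_lower_bound R V I _ m r (2 * x)%N P mem F p le_mr le_h cardP.
have {step} : p * #|I|%:R * (m%:R * (2 * x)%:R / r%:R) <=
    ln #|{: s.-tuple bool}|%:R + #|I|%:R.
  apply: step; rewrite -mulrA -natrM; apply: le_trans avg _; rewrite ler_nat.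
  apply: leq_sum => D XD; rewrite big_enum /=; apply: leq_sum => i _.
  have [/set_mem gD|//] := boolP (t \in ev (D, i)).
  by rewrite reveals // -run_eq.
have -> : m%:R * (2 * x)%:R / r%:R = N%:R / k%:R ^+ 2 :> R.
  have m_gt0 : (0 < m)%N.
    by rewrite -(ltn_pmul2r k_gt0) mul0n m_eq r_eq muln_gt0 x_gt0 andbT; lia.
  rewrite -m_eq NE !natrM; field; rewrite !pnatr_eq0 -!lt0n m_gt0 k_gt0 //.
(* [s] bits give [2 ^ s] states, and [ln 2 <= 1]. *)
move=> le_p; apply: (le_trans le_p); rewrite lerD2r card_tuple card_bool.
rewrite natrX lnXn // ler_wMn2r //.
by apply: (le_ln1Dx (x := 1)); lra.
Qed.

(** * Asymptotics of the instance size *)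

Lemma ln_le_tangent (R : realType) (a x : R) : 0 < a -> 0 < x ->
  ln x <= x / a + ln a.
Proof.
move=> a0 x0; rewrite -lerBlDr -ln_div ?posrE //.
by apply/ltW/ln_sublinear; rewrite divr_gt0.
Qed.

Lemma ln_linear_eventually (R : realType) (A B q : R) : 0 < A -> 0 < q ->
  exists W : nat, forall w : nat, (W <= w)%N ->
    B + A * ln (2 * w%:R) <= w%:R * q.
Proof.
(* With this slope the logarithm uses half of [w * q]; [w >= M] lets the other half absorb the
   constants. *)
move=> A0 q0; pose a := 4 * A / q.
have a0 : 0 < a by rewrite divr_gt0 ?mulr_gt0.
pose M := 2 * (B + A * ln a) / q.
have [W leMW] : exists W : nat, M <= W%:R.
  exists (Num.bound `|M|); rewrite (le_trans (ler_norm _)) // ltW //.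
  exact: archi_boundP.
exists W.+1 => w lew.
have w0 : 0 < w%:R :> R by rewrite ltr0n (leq_trans _ lew).
have Mw : M <= w%:R by rewrite (le_trans leMW) // ler_nat ltnW.
have tan : ln (2 * w%:R) <= 2 * w%:R / a + ln a.
  by apply: ln_le_tangent => //; rewrite mulr_gt0.
have tanA := ler_wpM2l (ltW A0) tan.
have E1 : A * (2 * w%:R / a) = w%:R * q / 2.
  by rewrite /a; field; rewrite !gt_eqF.
have E2 : B + A * ln a = M * q / 2 by rewrite /M; field; rewrite gt_eqF.
have : M * q <= w%:R * q by rewrite ler_wpM2r // ltW.
rewrite mulrDr E1 in tanA; lra.
Qed.

(** As [n] lies between consecutive instance sizes, [ln n] exceeds the last logarithm by only
    [O(ln w)]. Half of [w * ln 2] absorbs this and [D]; the other half pays for the [ln (ln n)]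
    term, since [ln n = O(w * ln w)]. *)
Lemma size_growth (R : realType) (b k : nat) (D : R) : (0 < b)%N -> (0 < k)%N ->
  exists W : nat, forall (w n : nat), (W <= w)%N ->
    (4 * (2 * w) ^ (w * b) <= n)%N ->
    (n <= 4 * (2 * (w + k)) ^ ((w + k) * b))%N ->
    (1 + ln 2 / (10 * b%:R) / ln (ln n%:R)) * ln n%:R + D <=
      w%:R * ln 2 + ln ((2 * w) ^ (w * b))%:R :> R.
Proof.
move=> b_gt0 k_gt0.
have b1 : 1 <= b%:R :> R by rewrite ler1n.
have k1 : 1 <= k%:R :> R by rewrite ler1n.
have b0 : 0 < b%:R :> R by rewrite ltr0n.
have k0 : 0 < k%:R :> R by rewrite ltr0n.
have L0 : 0 < ln 2 :> R by apply: ln_gt0; lra.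
have [W0 large] := @ln_linear_eventually R (b%:R * k%:R)
  (ln 4 + 2 * b%:R * k%:R + D) (ln 2 / 2) (mulr_gt0 b0 k0) (divr_gt0 L0 (ltr0Sn R 1)).
pose E := Num.bound (expR 1 : R).
have ltE : expR 1 < E%:R :> R by apply: archi_boundP; apply: expR_ge0.
exists (maxn W0 (maxn 4 (maxn k E))) => w n.
rewrite !geq_max => /and4P[leW le4 lek leE] le1 le2.
have {large} lin := large w leW.
have w4 : 4 <= w%:R :> R by rewrite ler_nat.
have wk : k%:R <= w%:R :> R by rewrite ler_nat.
have w0 : 0 < w%:R :> R by lra.
have w_gt0 : (0 < w)%N by rewrite -(ltr0n R).
have lnN (v : nat) : (0 < v)%N ->
    ln ((2 * v) ^ (v * b))%:R = b%:R * v%:R * ln (2 * v%:R) :> R.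
  move=> v_gt0; rewrite natrX lnXn; last by rewrite ltr0n muln_gt0.
  rewrite -[LHS]mulr_natr !natrM; ring.
have n0 : 0 < n%:R :> R.
  by rewrite ltr0n (leq_trans _ le1) // muln_gt0 expn_gt0 muln_gt0 w_gt0.
rewrite lnN //; set l := ln n%:R; set lam := ln (2 * w%:R) in lin *.
have lnw1 : 1 <= ln w%:R :> R.
  rewrite -ler_expR lnK ?posrE //; apply: (le_trans (ltW ltE)).
  by rewrite ler_nat.
have ln4w : ln 4 <= ln w%:R :> R by rewrite ler_ln ?posrE.
have lamE : lam = ln 2 + ln w%:R by rewrite /lam lnM ?posrE.
have bw1 : w%:R <= b%:R * w%:R :> R by rewrite ler_peMl // ltW.
have bk0 : 0 < b%:R * k%:R :> R by rewrite mulr_gt0.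
have lower_l : w%:R <= l.
  apply: (@le_trans _ _ (b%:R * w%:R * lam)).
    by rewrite (le_trans bw1) // ler_peMr ?mulr_ge0 ?ler0n //; lra.
  rewrite -lnN // ler_ln ?posrE //; last first.
    by rewrite ltr0n expn_gt0 muln_gt0 w_gt0.
  by rewrite ler_nat (leq_trans _ le1) // leq_pmull.
have l0 : 0 < l by lra.
have ll : ln w%:R <= ln l by rewrite ler_ln ?posrE.
have upper_l : l <= ln 4 + b%:R * (w%:R + k%:R) * ln (2 * (w%:R + k%:R)).
  have v_gt0 : (0 < w + k)%N by rewrite addn_gt0 w_gt0.
  have pw0 : 0 < ((2 * (w + k)) ^ ((w + k) * b))%:R :> R.
    by rewrite ltr0n expn_gt0 muln_gt0 v_gt0.
  rewrite -natrD -lnN // -lnM ?posrE // ler_ln ?posrE ?mulr_gt0 //.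
  by rewrite -natrM ler_nat.
have ln_wk : ln (2 * (w%:R + k%:R)) <= lam + k%:R / w%:R.
  have -> : 2 * (w%:R + k%:R) = 2 * w%:R * (1 + k%:R / w%:R) :> R.
    by field; rewrite gt_eqF.
  have kw0 : 0 < k%:R / w%:R :> R by rewrite divr_gt0.
  rewrite lnM ?posrE ?mulr_gt0 ?addr_gt0 //.
  by rewrite -/lam lerD2l le_ln1Dx //; lra.
have kw1 : k%:R / w%:R <= 1 :> R by rewrite ler_pdivrMr // mul1r.
have H1 : l <= b%:R * w%:R * lam + (ln 4 + b%:R * k%:R * lam + 2 * (b%:R * k%:R)).
  apply: (le_trans upper_l).
  have c0 : 0 <= b%:R * (w%:R + k%:R) :> R by rewrite mulr_ge0 // addr_ge0 // ltW.
  have := ler_wpM2l c0 ln_wk.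
  have -> : b%:R * (w%:R + k%:R) * (lam + k%:R / w%:R) =
      b%:R * w%:R * lam + b%:R * k%:R * lam + b%:R * k%:R
      + b%:R * k%:R * (k%:R / w%:R) by field; rewrite gt_eqF.
  have := ler_wpM2l (ltW bk0) kw1; lra.
(* Here [5 = 2 * 2 + 1], from [w + k <= 2 * w], [2 * (w + k) <= w ^ 2] and [4 <= w]; it yields the
   [10] in the exponent. *)
have H3 : l <= 5 * (b%:R * w%:R * ln w%:R).
  apply: (le_trans upper_l).
  have ln_wk2 : ln (2 * (w%:R + k%:R)) <= 2 * ln w%:R :> R.
    have -> : 2 * ln w%:R = ln (w%:R * w%:R) :> R by rewrite lnM ?posrE //; ring.
    rewrite ler_ln ?posrE ?mulr_gt0 ?addr_gt0 //.
    have : 4 * w%:R <= w%:R * w%:R :> R by rewrite ler_wpM2r // ltW.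
    lra.
  have c0 : 0 <= b%:R * (w%:R + k%:R) :> R by rewrite mulr_ge0 // addr_ge0 // ltW.
  have := ler_wpM2l c0 ln_wk2.
  have c1 : b%:R * (w%:R + k%:R) <= 2 * (b%:R * w%:R) :> R.
    have := ler_wpM2l (ltW b0) wk; lra.
  have lnw0 : 0 <= 2 * ln w%:R :> R by lra.
  have := ler_wpM2r lnw0 c1.
  have : ln w%:R <= b%:R * w%:R * ln w%:R :> R.
    by rewrite ler_peMl //; lra.
  lra.
have lnl0 : 0 < ln l by lra.
have H4 : ln 2 / (10 * b%:R) / ln l * l <= w%:R * ln 2 / 2.
  rewrite mulrAC ler_pdivrMr //.
  have c0 : 0 <= ln 2 / (10 * b%:R) :> R by rewrite divr_ge0 ?mulr_ge0 // ltW.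
  apply: (le_trans (ler_wpM2l c0 H3)).
  have -> : ln 2 / (10 * b%:R) * (5 * (b%:R * w%:R * ln w%:R)) =
      w%:R * ln 2 / 2 * ln w%:R :> R by field; rewrite gt_eqF.
  by rewrite ler_wpM2l // divr_ge0 ?mulr_ge0 // ltW.
rewrite mulrDl mul1r; lra.
Qed.

(** * Choice of the instance for a given [n] *)

Theorem theorem1 (R : realType) (eps p : R) (heps : 0 < eps) (hp : 0 < p) :
  exists2 c : R, 0 < c &
  exists n0 : nat, forall n : nat, (n0 <= n)%N ->
  forall (s : nat) (d : measure_display) (Omega : measurableType d)
    (P : probability Omega R) (a : rand_two_pass Omega n s),
    (forall w : Omega, greedy_first_pass (a w)) ->
    approximates P a (2 / 3 + eps) p ->
    n%:R `^ (1 + c / ln (ln n%:R)) <= s%:R.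
Proof.
have le_bound (x : R) : 0 <= x -> x <= (Num.bound x)%:R.
  by move=> x0; apply/ltW/archi_boundP.
pose k := maxn 3 (Num.bound (2 / eps)).
have k_gt2 : (2 < k)%N by rewrite leq_maxl.
have k_gt0 : (0 < k)%N by apply: leq_trans k_gt2.
have k0 : 0 < k%:R :> R by rewrite ltr0n.
have le_eps : 2 / k%:R <= eps.
  rewrite ler_pdivrMr // mulrC -ler_pdivrMr //.
  apply: (le_trans (le_bound _ (ltW (divr_gt0 (ltr0Sn R 1) heps)))).
  by rewrite ler_nat leq_maxr.
pose b := (4 ^ k)%N; have b_gt0 : (0 < b)%N by rewrite expn_gt0.
(* Half of [p / k ^ 2]: once [q * N >= 1], the other half absorbs the additive [K] of the space
   bound. *)
pose q := p / (2 * k%:R ^+ 2).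
have q0 : 0 < q by rewrite divr_gt0 ?mulr_gt0 ?exprn_gt0.
have [W growth] := size_growth (- ln q) b_gt0 k_gt0.
exists (ln 2 / (10 * b%:R)).
  by rewrite divr_gt0 ?mulr_gt0 ?ltr0n // ln_gt0 // ltr1n.
pose f u := (4 * (2 * (k * u)) ^ (k * u * b))%N.
pose u0 := maxn 1 (maxn W (Num.bound q^-1)).
exists (f u0) => n le_n s d Omega Pr a ga aa.
have ub_f u : (f u <= n)%N -> (u <= n)%N.
  apply: leq_trans; case: u => // u.
  apply: (@leq_trans ((2 * (k * u.+1)) ^ 1)%N); first by rewrite expn1; nia.
  rewrite /f (leq_trans _ (leq_pmull _ _)) // leq_pexp2l ?muln_gt0 ?k_gt0 //.
have ex_f : exists u, (f u <= n)%N by exists u0.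
(* Take the largest instance that fits into [n] vertices; by maximality the next one does not fit,
   which bounds [n] from above. *)
case: (ex_maxnP ex_f ub_f) => u le_fu max_u.
have le_u0 : (u0 <= u)%N by apply: max_u.
have u_gt0 : (0 < u)%N by apply: leq_trans le_u0; rewrite leq_maxl.
have le_uw : (u <= k * u)%N by rewrite leq_pmull.
have le_Ww : (W <= k * u)%N.
  by rewrite (leq_trans _ le_uw) // (leq_trans _ le_u0) // !leq_max leqnn orbT.
have lt_n : (n <= 4 * (2 * (k * u + k)) ^ ((k * u + k) * b))%N.
  rewrite -mulnSr leqNgt; apply/negP => lt_fn.
  by have := max_u _ (ltnW lt_fn); rewrite ltnn.
have {growth} := growth _ _ le_Ww le_fu lt_n.
have [K leK] := space_bound k_gt2 u_gt0 le_eps le_fu ga aa.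
rewrite -/b; move: le_fu; rewrite /f; set w := (k * u)%N; set N := (_ ^ (w * b))%N.
move=> le_fu le_s le_ln.
have w_gt0 : (0 < w)%N by rewrite muln_gt0 k_gt0.
have le_wN : (w <= N)%N.
  apply: (@leq_trans ((2 * w) ^ 1)%N); first by rewrite expn1 leq_pmull.
  by rewrite leq_pexp2l // !muln_gt0 k_gt0 u_gt0.
have N0 : 0 < N%:R :> R by rewrite ltr0n (leq_trans _ le_wN).
have qN1 : 1 <= q * N%:R.
  rewrite mulrC -ler_pdivrMr // div1r.
  apply: (le_trans (le_bound _ _)); first by rewrite invr_ge0 ltW.
  rewrite ler_nat (leq_trans _ le_wN) // (leq_trans _ le_uw) //.
  by rewrite (leq_trans _ le_u0) // !leq_max leqnn !orbT.
have n_gt0 : (0 < n)%N.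
  by rewrite (leq_trans _ le_fu) // muln_gt0 (leq_trans _ le_wN).
rewrite /powR pnatr_eq0 (gtn_eqF n_gt0) /=.
apply: (@le_trans _ _ ((2 ^ w)%:R * (q * N%:R))).
  have qN0 : 0 < q * N%:R by rewrite mulr_gt0.
  have pw0 : 0 < (2 ^ w)%:R :> R by rewrite ltr0n expn_gt0.
  have -> : (2 ^ w)%:R * (q * N%:R) = expR (w%:R * ln 2 + (ln q + ln N%:R)).
    have <- : ln (2 ^ w)%:R = w%:R * ln 2 :> R by rewrite natrX lnXn // mulr_natl.
    by rewrite -lnM ?posrE // -lnM ?posrE // lnK ?posrE ?(mulr_gt0 pw0 qN0).
  by rewrite ler_expR; lra.
have pE : p * K%:R * (N%:R / k%:R ^+ 2) = 2 * K%:R * (q * N%:R).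
  by rewrite /q; field; rewrite gt_eqF.
apply: (@le_trans _ _ (K%:R * (q * N%:R))).
  by rewrite ler_wpM2r ?ler_nat // mulr_ge0 // ltW.
have K0 : 0 <= K%:R :> R by rewrite ler0n.
have := ler_wpM2l K0 qN1; rewrite pE in le_s; lra.
Qed.
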